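(* Let $F$ be a field of characteristic not two and let $E$ be a finite-dimensional vector space over $F$ with an arbitrary symmetric bilinear form $(U,V)\mapsto U\cdot V$. Let $\overline{uvw}$ be a non-null projective triangle in $E$ with projective quadrances $q_u=q(v,w)$, $q_w=q(u,v)$ and projective spreads $S_u=S(uv,uw)$, $S_w=S(wu,wv)$ (assumed to be defined). If $S_w=1$, then $$S_u=\frac{q_u}{q_w}.$$
   Context: A projective point $u=[U]$ is a one-dimensional subspace of $E$, spanned by a non-zero vector $U$; it is null if $U\cdot U=0$, and non-null otherwise. For distinct projective points $u,v$, $uv$ denotes the projective line (two-dimensional subspace) they span. A projective triangle $\overline{uvw}$ is a set of three distinct projective points not contained in a common two-dimensional subspace; it is null if at least one of its projective points is null, and non-null otherwise. The projective quadrance between non-null projective points $u=[U]$, $v=[V]$ is $$q(u,v)=1-\frac{(U\cdot V)^2}{(U\cdot U)(V\cdot V)}.$$ The projective spread between the projective lines $wu$ and $wv$, where $u=[U]$, $v=[V]$, $w=[W]$ with $w$ non-null, is, putting $U'=U-\frac{U\cdot W}{W\cdot W}W$ and $V'=V-\frac{V\cdot W}{W\cdot W}W$, $$S(wu,wv)=1-\frac{(U'\cdot V')^2}{(U'\cdot U')(V'\cdot V')},$$ and it is undefined if one of the denominators is zero. Equivalently, with $a_X=X\cdot X$ and $b_{XY}=X\cdot Y$, $$S(wu,wv)=1-\frac{(a_Wb_{UV}-b_{UW}b_{VW})^2}{(a_Ua_W-b_{UW}^2)(a_Va_W-b_{VW}^2)}.$$ The bilinear form is not assumed non-degenerate. 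*)

(* Defs.v *)
From HB Require Import structures.
From mathcomp Require Import all_boot all_order all_algebra.
From mathcomp Require Import ring.

Set Implicit Arguments.
Unset Strict Implicit.
Unset Printing Implicit Defensive.

Import GRing.Theory.

Local Open Scope ring_scope.

Section ProjectivePoints.

Variables (F : fieldType) (E : vectType F).

Record ppoint := PPoint { psub :> {vspace E}; dim_psub : \dim psub == 1%N }.

HB.instance Definition _ := [isSub for psub].
HB.instance Definition _ := [Equality of ppoint by <:].

Definition ptriangle (u v w : ppoint) : Prop :=
  [/\ u != v, v != w, u != w &
      forall L : {vspace E}, \dim L = 2%N ->
        ~~ [&& (u <= L)%VS, (v <= L)%VS & (w <= L)%VS]].

End ProjectivePoints.

Section Metric.

Variables (F : fieldType) (E : vectType F) (B : {symmetric E}).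

Definition vquadrance (U V : E) : F := 1 - B U V ^+ 2 / (B U U * B V V).

Definition perp (W U : E) : E := U - (B U W / B W W) *: W.

(* [W] is the vertex: this is S(wu, wv) for w = [W], u = [U], v = [V]. *)
Definition vspread (W U V : E) : F := vquadrance (perp W U) (perp W V).

Definition vspread_defined (W U V : E) : bool :=
  [&& B W W != 0, B (perp W U) (perp W U) != 0
    & B (perp W V) (perp W V) != 0].

(* A projective point is represented by its [vpick]; the lemmas [pnullE],
   [pquadranceE], [pspread_definedE] and [pspreadE] below show that every
   spanning vector gives the same notions. *)
Definition pnull (u : ppoint E) : bool := B (vpick u) (vpick u) == 0.

Definition nonnull_ptriangle (u v w : ppoint E) : Prop :=
  ptriangle u v w /\ ~~ [|| pnull u, pnull v | pnull w].

Definition pquadrance (u v : ppoint E) : F := vquadrance (vpick u) (vpick v).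

(* [pspread w u v] is the spread S(wu, wv) between the lines wu and wv meeting
   at w; by [pspread_line] it depends only on w and on the two lines. *)
Definition pspread (w u v : ppoint E) : F :=
  vspread (vpick w) (vpick u) (vpick v).

Definition pspread_defined (w u v : ppoint E) : bool :=
  vspread_defined (vpick w) (vpick u) (vpick v).

Lemma vpick_line (u : ppoint E) (U : E) :
  u = <[U]>%VS :> {vspace E} -> exists2 c, c != 0 & vpick u = c *: U.
Proof.
move=> uU; have: vpick u \in <[U]>%VS by rewrite -uU memv_pick.
case/vlineP=> c cE; exists c => //.
have: vpick u != 0 by rewrite vpick0 -dimv_eq0 (eqP (dim_psub u)).
by rewrite cE; apply: contraNneq => ->; rewrite scale0r.
Qed.

Lemma ppoint_vpick (u : ppoint E) : u = <[vpick u]>%VS :> {vspace E}.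
Proof.
have u1 := eqP (dim_psub u).
apply/esym/eqP; rewrite eqEdim -memvE memv_pick /= dim_vline vpick0.
by rewrite -dimv_eq0 u1.
Qed.

Lemma BZl c (U V : E) : B (c *: U) V = c * B U V.
Proof. exact: linearZl_LR. Qed.

Lemma BZr c (U V : E) : B U (c *: V) = c * B U V.
Proof. exact: linearZr_LR. Qed.

Lemma BDl (U U' V : E) : B (U + U') V = B U V + B U' V.
Proof. exact: linearDl. Qed.

Lemma BC (U V : E) : B U V = B V U.
Proof. by rewrite hermC expr0 mul1r. Qed.

Lemma vquadrance_scale a b (U V : E) : a != 0 -> b != 0 ->
  vquadrance (a *: U) (b *: V) = vquadrance U V.
Proof.
move=> a0 b0; rewrite /vquadrance !BZl !BZr; congr (1 - _).
set x := B U V; set y := B U U; set z := B V V.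
rewrite (_ : (a * (b * x)) ^+ 2 = (a * b) ^+ 2 * x ^+ 2); last by ring.
rewrite (_ : a * (a * y) * (b * (b * z)) = (a * b) ^+ 2 * (y * z)); last by ring.
by rewrite -mulf_div divff ?mul1r // expf_neq0 // mulf_neq0.
Qed.

Lemma perp_scale c d (W U : E) : c != 0 -> B W W != 0 ->
  perp (c *: W) (d *: U) = d *: perp W U.
Proof.
move=> c0 W0; rewrite /perp scalerBr !BZl !BZr !scalerA.
by congr (_ - _ *: _); field; rewrite W0 c0.
Qed.

Lemma perp_line d b (W U : E) : B W W != 0 ->
  perp W (d *: U + b *: W) = d *: perp W U.
Proof.
move=> W0; rewrite /perp BDl !BZl scalerBr -addrA; congr (_ + _).
rewrite -scalerBl scalerA -scaleNr; congr (_ *: _).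
by field.
Qed.

Lemma pnullE (u : ppoint E) (U : E) :
  u = <[U]>%VS :> {vspace E} -> pnull u = (B U U == 0).
Proof.
case/vpick_line=> c c0 uE.
by rewrite /pnull uE BZl BZr !mulf_eq0 (negbTE c0).
Qed.

Lemma pquadranceE (u v : ppoint E) (U V : E) :
  u = <[U]>%VS :> {vspace E} -> v = <[V]>%VS :> {vspace E} ->
  pquadrance u v = vquadrance U V.
Proof.
case/vpick_line=> a a0 uE; case/vpick_line=> b b0 vE.
by rewrite /pquadrance uE vE vquadrance_scale.
Qed.

Lemma pspread_definedE (w u v : ppoint E) (W U V : E) :
  w = <[W]>%VS :> {vspace E} ->
  u = <[U]>%VS :> {vspace E} -> v = <[V]>%VS :> {vspace E} ->
  pspread_defined w u v = vspread_defined W U V.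
Proof.
case/vpick_line=> c c0 wE; case/vpick_line=> a a0 uE; case/vpick_line=> b b0 vE.
rewrite /pspread_defined /vspread_defined wE uE vE BZl BZr.
rewrite !mulf_eq0 (negbTE c0) /=; case: eqVneq => //= W0.
by rewrite !perp_scale // !BZl !BZr !mulf_eq0 (negbTE a0) (negbTE b0).
Qed.

Lemma pspreadE (w u v : ppoint E) (W U V : E) : ~~ pnull w ->
  w = <[W]>%VS :> {vspace E} ->
  u = <[U]>%VS :> {vspace E} -> v = <[V]>%VS :> {vspace E} ->
  pspread w u v = vspread W U V.
Proof.
move=> w0 wW; move: w0; rewrite (pnullE wW) => W0.
case/vpick_line: wW => c c0 wE.
case/vpick_line=> a a0 uE; case/vpick_line=> b b0 vE.
by rewrite /pspread /vspread wE uE vE !perp_scale // vquadrance_scale.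
Qed.

Lemma perp_pline (w u u' : ppoint E) : ~~ pnull w -> u' != w ->
  (w + u = w + u')%VS ->
  exists2 d, d != 0 & perp (vpick w) (vpick u') = d *: perp (vpick w) (vpick u).
Proof.
move=> w0 u'w luu'.
have: vpick u' \in (<[vpick u]> + <[vpick w]>)%VS.
  by rewrite -!ppoint_vpick addvC luu' (subvP (addvSr _ _)) ?memv_pick.
case/memv_addP=> _ /vlineP[d ->] [_ /vlineP[b ->] u'E].
exists d; last by rewrite u'E perp_line.
apply: contraNneq u'w => d0; apply/eqP/val_inj/eqP => /=.
rewrite eqEdim (eqP (dim_psub w)) (eqP (dim_psub u')) leqnn andbT.
by rewrite (ppoint_vpick u') -memvE u'E d0 scale0r add0r memvZ ?memv_pick.
Qed.

Lemma pspread_line (w u v u' v' : ppoint E) : ~~ pnull w ->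
  u' != w -> v' != w -> (w + u = w + u')%VS -> (w + v = w + v')%VS ->
  pspread w u' v' = pspread w u v.
Proof.
move=> w0 u'w v'w luu' lvv'.
have [d d0 dE] := perp_pline w0 u'w luu'.
have [e e0 eE] := perp_pline w0 v'w lvv'.
by rewrite /pspread /vspread dE eE vquadrance_scale.
Qed.

(* When S(wu, wv) is defined, q(w, u) is a legitimate denominator. *)
Lemma pspread_defined_quadrance (w u v : ppoint E) : ~~ pnull u ->
  pspread_defined w u v -> pquadrance w u != 0.
Proof.
rewrite /pnull /pspread_defined /pquadrance /vquadrance => u0 /and3P[w0 uw0 _].
move: u0 w0 uw0; set W := vpick w; set U := vpick u => u0 w0.
apply: contraNneq; rewrite /perp linearBl !linearBr /= !BZl !BZr (BC W U).
set x := B U W; set y := B W W => q0.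
have -> : B U U - x / y * x - (x / y * x - x / y * (x / y * y))
   = B U U * (1 - x ^+ 2 / (y * B U U)) by field; rewrite w0 u0.
by rewrite q0 mulr0.
Qed.

End Metric.

(* Main.v *)
Require Import Defs.
From mathcomp Require Import all_boot all_order all_algebra.
From mathcomp Require Import ring.

Import GRing.Theory.

Local Open Scope ring_scope.

(** The two invariants of metric projective trigonometry are quotients of Gram
determinants: writing G(U,V) for the determinant of the Gram matrix of U, V and
D for that of U, V, W, one has q(u,v) = G(U,V) / ((U.U) (V.V))
([vquadrance_gram]) and S(wu,wv) = (W.W) D / (G(W,U) G(W,V)) ([vspread_gram]).
As D is symmetric in the three vectors, it is shared by the three spreads of a
triangle.  When S_w = 1 the formula for S_w gives (W.W) D = G(W,U) G(W,V);
eliminating D from S_u = (U.U) D / (G(U,V) G(U,W)) cancels G(U,W) and leaves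
(U.U) G(V,W) / ((W.W) G(U,V)), which is q(v,w) / q(u,v).  Spreads
and quadrances being squared sines, this is the relation sin A = sin a / sin c
for a spherical triangle with a right angle at C. *)

Section Gram.

Variables (F : fieldType) (E : vectType F) (B : {symmetric E}).

Definition gram2 (U V : E) : F := B U U * B V V - B U V ^+ 2.

Definition gram3 (U V W : E) : F :=
  B U U * B V V * B W W + 2 * B U V * B V W * B U W
  - B U U * B V W ^+ 2 - B V V * B U W ^+ 2 - B W W * B U V ^+ 2.

Lemma gram2C (U V : E) : gram2 U V = gram2 V U.
Proof. by rewrite /gram2 (BC B V U); ring. Qed.

Lemma gram3_rot (U V W : E) : gram3 U V W = gram3 W U V.
Proof. by rewrite /gram3 (BC B W U) (BC B W V); ring. Qed.

Lemma form_perp (W U V : E) : B W W != 0 ->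
  B (perp B W U) (perp B W V) = B U V - B U W * B V W / B W W.
Proof.
move=> W0; rewrite /perp linearBl !linearBr /= !BZl !BZr (BC B W V).
by field.
Qed.

Lemma form_perp_gram2 (W U : E) : B W W != 0 ->
  B (perp B W U) (perp B W U) = gram2 W U / B W W.
Proof. by move=> W0; rewrite form_perp // /gram2 (BC B W U); field. Qed.

Lemma vquadrance_gram (U V : E) : B U U != 0 -> B V V != 0 ->
  vquadrance B U V = gram2 U V / (B U U * B V V).
Proof. by move=> U0 V0; rewrite /vquadrance /gram2; field; rewrite V0 U0. Qed.

Lemma vspread_defined_gram2 (W U V : E) : vspread_defined B W U V ->
  [/\ B W W != 0, gram2 W U != 0 & gram2 W V != 0].
Proof.
case/and3P=> W0; rewrite !form_perp_gram2 // !mulf_eq0 !invr_eq0.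
by rewrite !(negbTE W0) !orbF.
Qed.

(** Projecting U and V along W turns their Gram matrix into the matrix of 2 by 2
minors of the Gram matrix of U, V, W that contain the entry W.W, divided by W.W.
By the Desnanot-Jacobi identity, the determinant of these minors is (W.W) D. *)
Lemma vspread_gram (W U V : E) : vspread_defined B W U V ->
  vspread B W U V = B W W * gram3 U V W / (gram2 W U * gram2 W V).
Proof.
case/vspread_defined_gram2=> W0 WU0 WV0.
rewrite /vspread /vquadrance !form_perp_gram2 // form_perp //.
have jacobi : B W W * gram3 U V W
    = gram2 W U * gram2 W V - (B W W * B U V - B U W * B V W) ^+ 2.
  by rewrite /gram3 /gram2 (BC B W U) (BC B W V); ring.
by rewrite jacobi; field; rewrite W0 WU0 WV0.
Qed.

Lemma vspread_right_triangle (U V W : E) : B V V != 0 ->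
  vspread_defined B U V W -> vspread_defined B W U V ->
  vspread B W U V = 1 ->
  vspread B U V W = vquadrance B V W / vquadrance B U V.
Proof.
move=> V0 defU defW.
have [U0 UV0 UW0] := vspread_defined_gram2 _ _ _ defU.
have [W0 WU0 WV0] := vspread_defined_gram2 _ _ _ defW.
rewrite !vspread_gram // !vquadrance_gram // (gram3_rot V W U) => SW1.
have D_eq : gram3 U V W = gram2 U W * gram2 V W / B W W.
  rewrite (gram2C U W) (gram2C V W); apply: (mulfI W0).
  by rewrite mulrCA mulfV // mulr1; apply: divr1_eq.
by rewrite D_eq; field; rewrite U0 V0 W0 UV0 UW0.
Qed.

End Gram.

Theorem theorem10 (F : fieldType) (charF : 2%N \notin [pchar F])
  (E : vectType F) (B : {symmetric E}) (u v w : ppoint E)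
  (uvw : nonnull_ptriangle B u v w)
  (defSu : pspread_defined B u v w) (defSw : pspread_defined B w u v) :
  pspread B w u v = 1 ->
  pspread B u v w = pquadrance B v w / pquadrance B u v.
Proof.
case: uvw => _; rewrite !negb_or => /and3P[_ v0 _].
exact: vspread_right_triangle.
Qed.
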